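(* Let $(A,\le,\odot,\rightarrow,0,1)$ be a bounded MLUB-complete residuated poset and let $B,C,D,E\in\mathcal P_+(A)$. Then: (1) $B\boxdot\{1\}=\operatorname{Max}LU(B)$ and $\{1\}\Rightarrow B=\operatorname{Min}U(B)$; (2) $B\boxdot C=C\boxdot B$; (3) if $B\le U(C)$ and $D\le U(E)$ then $B\boxdot D\le U(C\boxdot E)$; (4) $B\boxdot C\le U(D)$ if and only if $B\le C\Rightarrow D$; (5) $L(C\Rightarrow D)\boxdot C\le U(D)$ and $C\le L(C\Rightarrow D)\Rightarrow D$.
   Context: A residuated poset $(A,\le,\odot,\rightarrow,0,1)$ is a bounded poset with binary operations $\odot,\rightarrow:A\times A\to A$ such that for all $x,y,z,v\in A$: $x\odot1=x$; $x\odot y=y\odot x$; $x\odot(y\odot z)=(x\odot y)\odot z$; if $x\le v$ and $y\le z$ then $x\odot y\le v\odot z$; $x\odot y\le z$ iff $x\le y\rightarrow z$. For $X\subseteq A$: $L(X)$, $U(X)$ are the sets of lower/upper bounds, $\operatorname{Max}X,\operatorname{Min}X$ the maximal/minimal elements. MLUB-complete: for every nonempty $M\subseteq A$, every upper bound of $M$ lies above a minimal upper bound and every lower bound lies below a maximal lower bound. $\mathcal P_+(A)$ = nonempty subsets of $A$; for subsets $X,Y$, $X\le Y$ iff $x\le y$ for all $x\in X,y\in Y$. For $B,C\in\mathcal P_+(A)$: $B\boxdot C=\operatorname{Max}LU(\{b\odot c\mid b\in B,c\in C\})$ and $B\Rightarrow C=\operatorname{Min}U\big(\bigcap\{L(b\rightarrow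 d)\mid b\in B,\ d\in U(C)\}\big)$. *)

(* Defs.v *)
From HB Require Import structures.
From mathcomp Require Import all_boot all_order.
From mathcomp Require Import boolp classical_sets.

Set Implicit Arguments.
Unset Strict Implicit.
Unset Printing Implicit Defensive.

Local Open Scope order_scope.
Local Open Scope classical_set_scope.

Declare Scope residuated_scope.
Delimit Scope residuated_scope with RP.
Local Open Scope residuated_scope.

Reserved Notation "x \odot y" (at level 40, left associativity).
Reserved Notation "x \imp y" (at level 55, right associativity).
Reserved Notation "B \boxdot C" (at level 40, left associativity).
Reserved Notation "B \Imp C" (at level 55, right associativity).
Reserved Notation "X \leS Y" (at level 70, no associativity).

(* The constants 0 and 1 of a residuated poset are \bot and \top. *)
HB.mixin Record isResiduated (d : Order.disp_t) A of Order.TBPOrder d A := {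
  rmul : A -> A -> A;
  rimp : A -> A -> A;
  rmul1 : forall x : A, rmul x \top = x;
  rmulC : forall x y : A, rmul x y = rmul y x;
  rmulA : forall x y z : A, rmul x (rmul y z) = rmul (rmul x y) z;
  rmul_le : forall x y z v : A, x <= v -> y <= z -> rmul x y <= rmul v z;
  radj : forall x y z : A, rmul x y <= z <-> x <= rimp y z }.

#[short(type="residuatedPOrderType")]
HB.structure Definition ResiduatedPOrder (d : Order.disp_t) :=
  { A of Order.TBPOrder d A & isResiduated d A }.

Notation "x \odot y" := (rmul x y) : residuated_scope.
Notation "x \imp y" := (rimp x y) : residuated_scope.

Section PosetNotions.
Context (d : Order.disp_t) (A : porderType d).
Implicit Types X Y : set A.

Definition Max X : set A := [set x | X x /\ forall y, X y -> x <= y -> y = x].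
Definition Min X : set A := [set x | X x /\ forall y, X y -> y <= x -> y = x].

Definition set_le X Y : Prop := forall x y, X x -> Y y -> x <= y.

Definition MLUB_complete : Prop := forall M : set A, M !=set0 ->
  (forall u, ubound M u -> exists2 m, Min (ubound M) m & m <= u) /\
  (forall l, lbound M l -> exists2 m, Max (lbound M) m & l <= m).

End PosetNotions.

Arguments MLUB_complete {d} A.
Notation "X \leS Y" := (set_le X Y) : residuated_scope.

Section ResiduatedSets.
Context (d : Order.disp_t) (A : residuatedPOrderType d).
Implicit Types B C : set A.

Definition boxdot B C : set A :=
  Max (lbound (ubound [set b \odot c | b in B & c in C])).

Definition Imp B C : set A :=
  Min (ubound (\bigcap_(p in B `*` ubound C) lbound [set p.1 \imp p.2])).

End ResiduatedSets.

Notation "B \boxdot C" := (boxdot B C) : residuated_scope.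
Notation "B \Imp C" := (Imp B C) : residuated_scope.

(* Main.v *)
(** The elementwise products and implications of sets satisfy the residuation
    law [B C <= X <-> B <= (C -> X)] for the relation [\leS].
    MLUB-completeness gives [U(Max(L(M))) = U(L(M))] and, dually,
    [L(Min(U(M))) = L(U(M))], so the closures in the definitions of
    [B \boxdot C] and [B \Imp C] change neither the upper bounds of the former
    nor the lower bounds of the latter, and the law carries over to them. *)
Require Import Defs.
From mathcomp Require Import all_boot all_order.
From mathcomp Require Import classical_sets.

Set Implicit Arguments.
Unset Strict Implicit.
Unset Printing Implicit Defensive.

Import Order.TTheory.

Local Open Scope order_scope.
Local Open Scope classical_set_scope.
Local Open Scope residuated_scope.

Section SetLe.
Context (d : Order.disp_t) (A : porderType d).
Implicit Types X Y Z : set A.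

Lemma set_leEubound X Y : X \leS Y <-> Y `<=` ubound X.
Proof.
by split=> [le_XY y Yy x Xx | sYX x y Xx /sYX]; [exact: le_XY | exact].
Qed.

Lemma set_leElbound X Y : X \leS Y <-> X `<=` lbound Y.
Proof.
by split=> [le_XY x Xx y Yy | sXY x y /sXY Xx]; [exact: le_XY | exact: Xx].
Qed.

Lemma set_le_ubound X : X \leS ubound X.
Proof. exact/set_leEubound. Qed.

Lemma lbound_set_le X : lbound X \leS X.
Proof. exact/set_leElbound. Qed.

Lemma set_le_ubound_trans X Y Z : X \leS ubound Y -> Y \leS Z -> X \leS Z.
Proof. by move=> le_XUY /set_leEubound sZUY x z Xx /sZUY; exact: le_XUY. Qed.

End SetLe.

Section Bounds.
Context (d : Order.disp_t) (A : porderType d).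
Implicit Type X : set A.

Lemma ubound_lbound_ubound X : ubound (lbound (ubound X)) = ubound X.
Proof.
apply/seteqP; split=> u Uu x Xx; last exact: Xx.
by apply: Uu => v; apply.
Qed.

Lemma ubound_Max X :
  (forall x, X x -> exists2 m, Max X m & x <= m) -> ubound (Max X) = ubound X.
Proof.
move=> below_Max; apply/seteqP; split=> u Uu x; last by case=> /Uu.
by move=> /below_Max[m /Uu le_mu le_xm]; exact: le_trans le_mu.
Qed.

End Bounds.

Section DualBounds.
Context (d : Order.disp_t) (A : porderType d).
Implicit Type X : set A.

Lemma lbound_ubound_lbound X : lbound (ubound (lbound X)) = lbound X.
Proof. exact: (@ubound_lbound_ubound _ A^d). Qed.

Lemma lbound_Min X :
  (forall x, X x -> exists2 m, Min X m & m <= x) -> lbound (Min X) = lbound X.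
Proof. exact: (@ubound_Max _ A^d). Qed.

End DualBounds.

Section MLUBComplete.
Context (d : Order.disp_t) (A : porderType d) (hA : MLUB_complete A).
Implicit Type M : set A.

Lemma ubound_Max_lbound M :
  M !=set0 -> ubound (Max (lbound M)) = ubound (lbound M).
Proof. by case/hA => _; exact: ubound_Max. Qed.

Lemma lbound_Min_ubound M :
  M !=set0 -> lbound (Min (ubound M)) = lbound (ubound M).
Proof. by case/hA => + _; exact: lbound_Min. Qed.

End MLUBComplete.

Lemma has_ubound_top (d : Order.disp_t) (A : tPOrderType d) (X : set A) :
  has_ubound X.
Proof. by exists \top => x _; exact: lex1. Qed.

Lemma has_lbound_bot (d : Order.disp_t) (A : bPOrderType d) (X : set A) :
  has_lbound X.
Proof. by exists \bot => x _; exact: le0x. Qed.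

Section SetResiduation.
Context (d : Order.disp_t) (A : residuatedPOrderType d).
Implicit Types B C D E X : set A.

Definition set_rmul B C : set A := [set b \odot c | b in B & c in C].

Definition set_rimp B C : set A := [set b \imp c | b in B & c in C].

Lemma rimp1x (x : A) : \top \imp x = x.
Proof.
apply/le_anti/andP; split; last by apply/radj; rewrite rmul1.
by rewrite -[leLHS]rmul1; apply/radj.
Qed.

Lemma set_rmulx1 B : set_rmul B [set \top] = B.
Proof.
apply/seteqP; split=> [_ [b Bb [_ -> <-]] | b Bb]; first by rewrite rmul1.
by exists b => //; exists \top; rewrite ?rmul1.
Qed.

Lemma set_rimp1x B : set_rimp [set \top] B = B.
Proof.
apply/seteqP; split=> [_ [_ -> [b Bb <-]] | b Bb]; first by rewrite rimp1x.
by exists \top => //; exists b; rewrite ?rimp1x.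
Qed.

Lemma set_rmulC B C : set_rmul B C = set_rmul C B.
Proof.
by apply/seteqP; split=> _ [b Bb [c Cc <-]]; exists c => //; exists b;
  rewrite // rmulC.
Qed.

Lemma set_radj B C X : set_rmul B C \leS X <-> B \leS set_rimp C X.
Proof.
split=> [le_BCX b _ Bb [c Cc [x Xx <-]] | le_BCX _ x [b Bb [c Cc <-]] Xx].
  by apply/radj/le_BCX => //; exists b => //; exists c.
by apply/radj/le_BCX => //; exists c => //; exists x.
Qed.

(* Residuating twice lets each factor be replaced separately. *)
Lemma set_rmul_le_ubound B C D E : B \leS ubound C -> D \leS ubound E ->
  set_rmul B D \leS ubound (set_rmul C E).
Proof.
move=> le_BUC le_DUE; rewrite set_rmulC.
apply/set_radj/(set_le_ubound_trans le_DUE)/set_radj; rewrite set_rmulC.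
apply/set_radj/(set_le_ubound_trans le_BUC)/set_radj.
exact: set_le_ubound.
Qed.

End SetResiduation.

Section ResiduatedSetsTheory.
Context (d : Order.disp_t) (A : residuatedPOrderType d).
Implicit Types B C D E X : set A.

Lemma boxdotE B C : B \boxdot C = Max (lbound (ubound (set_rmul B C))).
Proof. by []. Qed.

Lemma ImpE B C : B \Imp C = Min (ubound (lbound (set_rimp B (ubound C)))).
Proof.
rewrite /Imp; congr (Min (ubound _)); apply/seteqP; split=> l Ll.
  by move=> _ [b Bb [u Uu <-]]; apply: (Ll (b, u)).
by move=> [b u] [/= Bb Uu] _ ->; apply: Ll; exists b => //; exists u.
Qed.

Lemma boxdotx1 B : B \boxdot [set \top] = Max (lbound (ubound B)).
Proof. by rewrite boxdotE set_rmulx1. Qed.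

Lemma Imp1x B : [set \top] \Imp B = Min (ubound B).
Proof. by rewrite ImpE set_rimp1x ubound_lbound_ubound. Qed.

Lemma boxdotC B C : B \boxdot C = C \boxdot B.
Proof. by rewrite !boxdotE set_rmulC. Qed.

Hypothesis hA : MLUB_complete A.

Lemma ubound_boxdot B C : ubound (B \boxdot C) = ubound (set_rmul B C).
Proof.
by rewrite boxdotE (ubound_Max_lbound hA (has_ubound_top _))
  ubound_lbound_ubound.
Qed.

Lemma lbound_Imp B C : lbound (B \Imp C) = lbound (set_rimp B (ubound C)).
Proof.
by rewrite ImpE (lbound_Min_ubound hA (has_lbound_bot _)) lbound_ubound_lbound.
Qed.

Lemma boxdot_set_le B C X : B \boxdot C \leS X <-> set_rmul B C \leS X.
Proof. by rewrite !set_leEubound ubound_boxdot. Qed.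

Lemma set_le_Imp X B C : X \leS (B \Imp C) <-> X \leS set_rimp B (ubound C).
Proof. by rewrite !set_leElbound lbound_Imp. Qed.

Lemma boxdot_Imp_adj B C D : B \boxdot C \leS ubound D <-> B \leS (C \Imp D).
Proof. by rewrite boxdot_set_le set_radj set_le_Imp. Qed.

Lemma boxdot_le_ubound B C D E : B \leS ubound C -> D \leS ubound E ->
  B \boxdot D \leS ubound (C \boxdot E).
Proof.
by rewrite boxdot_set_le ubound_boxdot; exact: set_rmul_le_ubound.
Qed.

Lemma lbound_Imp_boxdot C D : lbound (C \Imp D) \boxdot C \leS ubound D.
Proof. exact/boxdot_Imp_adj/lbound_set_le. Qed.

Lemma set_le_lbound_Imp_Imp C D : C \leS (lbound (C \Imp D) \Imp D).
Proof. by apply/boxdot_Imp_adj; rewrite boxdotC; exact: lbound_Imp_boxdot. Qed.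

End ResiduatedSetsTheory.

Theorem theorem7p4 (d : Order.disp_t) (A : residuatedPOrderType d)
    (hA : MLUB_complete A) (B C D E : set A)
    (hB : B !=set0) (hC : C !=set0) (hD : D !=set0) (hE : E !=set0) :
  (B \boxdot [set \top] = Max (lbound (ubound B)) /\
     [set \top] \Imp B = Min (ubound B)) /\
  (B \boxdot C = C \boxdot B) /\
  (B \leS ubound C -> D \leS ubound E ->
     B \boxdot D \leS ubound (C \boxdot E)) /\
  (B \boxdot C \leS ubound D <-> B \leS (C \Imp D)) /\
  (lbound (C \Imp D) \boxdot C \leS ubound D /\
     C \leS (lbound (C \Imp D) \Imp D)).
Proof.
split; first by split; [exact: boxdotx1 | exact: Imp1x].
split; first exact: boxdotC.
split; first exact: boxdot_le_ubound.
split; first exact: boxdot_Imp_adj.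
by split; [exact: lbound_Imp_boxdot | exact: set_le_lbound_Imp_Imp].
Qed.
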